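(* Let $X$ be a Banach space and $Y\subseteq X$ a subspace. (i) If $Y$ is reflexive and $X$ has property (K), then $X/Y$ has property (K). (ii) If $Y$ is Grothendieck and $X/Y$ has property (K), then $X$ has property (K).
   Context: All linear spaces are real; a subspace of a Banach space is a closed linear subspace. Given a sequence $(x_n)$ in a linear space, a convex block subsequence of $(x_n)$ is a sequence $(y_k)$ of the form $y_k=\sum_{n\in I_k}a_n x_n$, where $(I_k)$ is a sequence of finite subsets of $\mathbb{N}$ with $\max(I_k)<\min(I_{k+1})$ and $(a_n)$ is a sequence of non-negative real numbers with $\sum_{n\in I_k}a_n=1$ for all $k\in\mathbb{N}$. For a Banach space $X$, the Mackey topology $\mu(X^*,X)$ on $X^*$ is the topology of uniform convergence on weakly compact subsets of $X$. A Banach space $X$ has property (K) if every $w^*$-convergent sequence in $X^*$ admits a convex block subsequence which is $\mu(X^*,X)$-convergent. A Banach space $X$ is Grothendieck if every $w^*$-convergent sequence in $X^*$ is weakly convergent. *)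

(* Defs.v *)
From HB Require Import structures.
From mathcomp Require Import all_boot all_order all_algebra finmap.
From mathcomp Require Import all_classical all_reals all_analysis.

Set Implicit Arguments.
Unset Strict Implicit.
Unset Printing Implicit Defensive.

Import Order.TTheory GRing.Theory Num.Theory.
Import numFieldNormedType.Exports.

Local Open Scope classical_set_scope.
Local Open Scope ring_scope.

Record closedSubspace (R : realType) (X : normedModType R) := ClosedSubspace {
  csub_pred :> {pred X};
  csub_submod : submod_closed csub_pred;
  csub_closed : closed [set x | x \in csub_pred] }.

HB.instance Definition _ (R : realType) (X : normedModType R)
    (Y : closedSubspace X) :=
  GRing.isSubmodClosed.Build R X (csub_pred Y)
    (GRing.submod_closed_semi (csub_submod Y)).

Record csubType (R : realType) (X : normedModType R) (Y : closedSubspace X) :=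
  CSub { csub_val :> X; csub_valP : csub_val \in csub_pred Y }.

Section CSubType.
Context {R : realType} {X : normedModType R} (Y : closedSubspace X).

HB.instance Definition _ := [isSub of csubType Y for @csub_val R X Y].
HB.instance Definition _ := [Choice of csubType Y by <:].
HB.instance Definition _ := [SubChoice_isSubLmodule of csubType Y by <:].

Definition csub_norm (y : csubType Y) : R := `|csub_val y|.

Let csub_normD x y : csub_norm (x + y) <= csub_norm x + csub_norm y.
Proof. exact: ler_normD. Qed.

Let csub_normZ (l : R) x : csub_norm (l *: x) = `|l| * csub_norm x.
Proof. exact: normrZ. Qed.

Let csub_norm_eq0 x : csub_norm x = 0 -> x = 0.
Proof. by move=> /eqP; rewrite normr_eq0 => /eqP x0; exact: val_inj. Qed.

HB.instance Definition _ :=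
  Lmodule_isNormed.Build R (csubType Y) csub_normD csub_normZ csub_norm_eq0.

End CSubType.

Section CSubComplete.
Context {R : realType} {X : completeNormedModType R} (Y : closedSubspace X).

Let csub_complete (F : set_system (csubType Y)) :
  ProperFilter F -> cauchy F -> cvg F.
Proof.
move=> FF /cauchy_ballP Fc.
have vFc : cauchy (@csub_val R X Y @ F).
  apply/cauchy_ballP => e e0; have [[/= A B] [FA FB] AB] := Fc e e0.
  exists ((@csub_val R X Y) @` A, (@csub_val R X Y) @` B) => /=.
    split; rewrite /nbhs/= /fmap/=.
      by apply: filterS FA => x Ax; exists x.
    by apply: filterS FB => x Bx; exists x.
  move=> [_ _] [/= [x Ax <-] [y By <-]].
  by have := AB (x, y) (conj Ax By); rewrite -!ball_normE.
have /cauchy_cvgP/cvg_ex[/= l vFl] := vFc.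
have Yl : l \in csub_pred Y.
  apply: (@csub_closed R X Y) => B /vFl FB.
  have [y By] := @filter_ex _ F _ _ FB.
  by exists (csub_val y); split=> //; exact: csub_valP.
apply/cvg_ex; exists (CSub Yl); apply/cvgrPdist_lt => e e0.
by move/cvgrPdist_lt: vFl => /(_ e e0).
Qed.

HB.instance Definition _ := Uniform_isComplete.Build (csubType Y) csub_complete.

End CSubComplete.

(* The algebraic quotient of X by Y, equipped below with the norm
   |q| = inf of |x| over the representatives x of q; it is complete when X is.
   *)
Definition quotient_space (R : realType) (X : normedModType R)
  (Y : closedSubspace X) : Type := Quotient.quot (csub_pred Y).

Section QuotientSpace.
Context {R : realType} {X : normedModType R} (Y : closedSubspace X).
Local Notation Q := (quotient_space Y).

HB.instance Definition _ := GRing.Zmodule.on Q.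

Definition qproj (x : X) : Q := (\pi_(Quotient.quot (csub_pred Y)) x)%qT.

Lemma qproj_zmod_morphism : zmod_morphism qproj.
Proof. by move=> x y; rewrite /qproj raddfB. Qed.

HB.instance Definition _ := GRing.isZmodMorphism.Build X Q qproj
  qproj_zmod_morphism.

Lemma qproj_eq (x y : X) : (qproj x = qproj y) <-> (x - y \in csub_pred Y).
Proof. by rewrite Quotient.idealrBE; split=> /eqP. Qed.

Lemma qproj_repr (q : Q) :
  qproj (repr (q : Quotient.quot (csub_pred Y))) = q.
Proof. exact: reprK. Qed.

Lemma qproj_surj (q : Q) : exists x, qproj x = q.
Proof. by exists (repr (q : Quotient.quot (csub_pred Y))); exact: reprK. Qed.

Definition qscale (l : R) (q : Q) : Q :=
  qproj (l *: repr (q : Quotient.quot (csub_pred Y))).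

Lemma qproj_scale l x : qproj (l *: x) = qscale l (qproj x).
Proof.
apply/qproj_eq; rewrite -scalerBr rpredZ//.
by apply/qproj_eq; rewrite qproj_repr.
Qed.

Let qscaleA a b q : qscale a (qscale b q) = qscale (a * b) q.
Proof. by have [x <-] := qproj_surj q; rewrite -!qproj_scale scalerA. Qed.

Let qscale1 : left_id 1 qscale.
Proof. by move=> q; have [x <-] := qproj_surj q; rewrite -qproj_scale scale1r. Qed.

Let qscaleDr : right_distributive qscale +%R.
Proof.
move=> a q r; have [x <-] := qproj_surj q; have [y <-] := qproj_surj r.
by rewrite -raddfD -!qproj_scale -raddfD scalerDr.
Qed.

Let qscaleDl q : {morph qscale^~ q : a b / a + b}.
Proof.
move=> a b; have [x <-] := qproj_surj q.
by rewrite -!qproj_scale scalerDl raddfD.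
Qed.

HB.instance Definition _ := GRing.Zmodule_isLmodule.Build R Q
  qscaleA qscale1 qscaleDr qscaleDl.

Definition qnorm (q : Q) : R := inf [set `|x| | x in [set x | qproj x = q]].

Lemma qnorm_has_inf q : has_inf [set `|x| | x in [set x | qproj x = q]].
Proof.
split; first by have [x xq] := qproj_surj q; exists `|x|; exists x.
by exists 0 => _ [x _ <-].
Qed.

Lemma qnorm_le x : qnorm (qproj x) <= `|x|.
Proof. by apply: ge_inf; [case: (qnorm_has_inf (qproj x))|exists x]. Qed.

Lemma qnorm_lt q e : qnorm q < e -> exists2 x, qproj x = q & `|x| < e.
Proof.
move=> qe; have := inf_lt (proj1 (qnorm_has_inf q)) qe.
by move=> [_ [x xq <-] xe]; exists x.
Qed.

Lemma qnorm_ge0 q : 0 <= qnorm q.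
Proof. by apply: lb_le_inf; [case: (qnorm_has_inf q)|move=> _ [x _ <-]]. Qed.

Let qnormD p q : qnorm (p + q) <= qnorm p + qnorm q.
Proof.
apply/ler_addgt0Pr => e e0.
have [x xp xe] : exists2 x, qproj x = p & `|x| < qnorm p + e / 2.
  by apply: qnorm_lt; rewrite ltrDl divr_gt0.
have [y yq ye] : exists2 y, qproj y = q & `|y| < qnorm q + e / 2.
  by apply: qnorm_lt; rewrite ltrDl divr_gt0.
rewrite -xp -yq -raddfD (le_trans (qnorm_le _))// (le_trans (ler_normD _ _))//.
by rewrite xp yq [e]splitr addrACA lerD// ltW.
Qed.

Let qnorm_scale_le (l : R) q : qnorm (l *: q) <= `|l| * qnorm q.
Proof.
have [->|l0] := eqVneq l 0.
  rewrite scale0r normr0 mul0r -(raddf0 qproj) (le_trans (qnorm_le _))//.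
  by rewrite normr0.
rewrite -ler_pdivrMl ?normr_gt0//; apply: lb_le_inf.
  by case: (qnorm_has_inf q).
move=> _ [x xq <-]; rewrite ler_pdivrMl ?normr_gt0// -normrZ -xq.
by rewrite [_ *: _](esym (qproj_scale l x)) qnorm_le.
Qed.

Let qnormZ (l : R) q : qnorm (l *: q) = `|l| * qnorm q.
Proof.
apply/eqP; rewrite eq_le qnorm_scale_le/=.
have [->|l0] := eqVneq l 0; first by rewrite normr0 mul0r qnorm_ge0.
rewrite -ler_pdivlMl ?normr_gt0// -normfV (le_trans _ (qnorm_scale_le _ _))//.
by rewrite scalerA mulVf// scale1r.
Qed.

Let qnorm_eq0 q : qnorm q = 0 -> q = 0.
Proof.
move=> q0; have [x xq] := qproj_surj q.
suff : x \in csub_pred Y.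
  by rewrite -[x in x \in _]subr0 -xq -(raddf0 qproj) => /qproj_eq.
apply: (@csub_closed R X Y) => B /nbhs_normP[e /= e0 xeB].
have [y yq ye] : exists2 y, qproj y = q & `|y| < e by apply: qnorm_lt; rewrite q0.
exists (x - y); split; last by apply: xeB => /=; rewrite opprB addrC subrK.
by apply/qproj_eq; rewrite xq yq.
Qed.

HB.instance Definition _ :=
  Lmodule_isNormed.Build R Q qnormD qnormZ qnorm_eq0.

End QuotientSpace.

Section QuotientComplete.
Context {R : realType} {X : completeNormedModType R} (Y : closedSubspace X).
Local Notation Q := (quotient_space Y).

Let quotient_complete (F : set_system Q) :
  ProperFilter F -> cauchy F -> cvg F.
Proof.
move=> FF /cauchyP Fc.
pose r (n : nat) : R := 2^-1 ^+ n.
have r0 n : 0 < r n by rewrite exprn_gt0// invr_gt0.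
have r_half n : r n.+1 <= r n.
  by rewrite [leLHS]exprS; apply: ler_piMl; [exact: ltW|rewrite invf_le1 ?ler1n].
have [q Fq] : {q : nat -> Q & forall n, F (ball (q n) (r n))}.
  by apply: (@choice _ _ (fun n q => F (ball q (r n)))) => n; exact: Fc.
have q_step n : `|q n.+1 - q n| < 2 * r n.
  have [p [/= pn pn1]] := filter_ex (filterI (Fq n) (Fq n.+1)).
  move: pn pn1; rewrite -!ball_normE/= => pn pn1.
  rewrite mulr_natl mulr2n (le_lt_trans (ler_distD p _ _))//.
  by apply: ltrD; [exact: lt_le_trans pn1 _|rewrite distrC].
have [d dP] : {d : nat -> X &
    forall n, qproj Y (d n) = q n.+1 - q n /\ `|d n| < 2 * r n}.
  apply: (@choice _ _ (fun n d => qproj Y d = q n.+1 - q n /\ `|d| < 2 * r n)).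
  by move=> n; have [x ? ?] := qnorm_lt (q_step n); exists x.
have [x0 x0q] := qproj_surj (q 0%N).
have /cvg_ex[/= s ds] : cvgn (series d).
  apply: normed_cvg; apply: (@series_le_cvg _ _ (geometric 2 2^-1)).
  - by move=> n; exact: normr_ge0.
  - by move=> n; rewrite /= mulr_ge0// exprn_ge0// invr_ge0.
  - by move=> n; have [_ /ltW] := dP n.
  - apply: is_cvg_geometric_series.
    by rewrite ger0_norm ?invr_ge0// invf_lt1// ltr1n.
have q_series n : qproj Y (x0 + series d n) = q n.
  rewrite raddfD/= seriesEnat/= raddf_sum x0q.
  have dq i : true -> qproj Y (d i) = q i.+1 - q i by case: (dP i).
  rewrite [X in _ + X](eq_bigr _ dq).
  by rewrite telescope_sumr// addrC subrK.
apply/cvg_ex; exists (qproj Y (x0 + s)); apply/cvgrPdist_lt => e e0.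
have e4 : 0 < e / 4 by rewrite divr_gt0.
have [n [sn rn]] : exists n, `|s - series d n| < e / 2 /\ r n < e / 2.
  have r_cvg : r @ \oo --> (0 : R).
    apply: cvg_expr.
    by rewrite ger0_norm ?invr_ge0// invf_lt1// ltr1n.
  have e2 : 0 < e / 2 by rewrite divr_gt0.
  move/cvgrPdist_lt : ds => /(_ _ e2) ds.
  move/cvgrPdist_lt : r_cvg => /(_ _ e2) r_cvg.
  have [n [/= sn rn]] := filter_ex (filterI ds r_cvg).
  exists n; split => //.
  by move: rn; rewrite sub0r normrN ger0_norm ?ltW.
apply: filterS (Fq n) => p; rewrite -ball_normE/= => qp.
rewrite (le_lt_trans (ler_distD (q n) _ _))// [e]splitr ltrD//.
  rewrite -[q n]q_series -raddfB/= opprD addrACA subrr add0r.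
  exact: le_lt_trans (qnorm_le _ _) sn.
exact: lt_trans qp rn.
Qed.

HB.instance Definition _ := Uniform_isComplete.Build Q quotient_complete.

End QuotientComplete.

Section Dual.
Context {R : realType} (X : normedModType R).

(* R^o is R seen as a normed module over itself, as required of the codomain
   of a linear map. *)
Definition dual_pred : {pred X -> R^o} :=
  fun f => `[< linear f /\ continuous f >].

Lemma dual_predP (f : X -> R^o) :
  reflect (linear f /\ continuous f) (f \in dual_pred).
Proof. exact: asboolP. Qed.

Lemma dual_submod_closed : submod_closed dual_pred.
Proof.
split.
  apply/dual_predP; split; last by move=> x; exact: cvg_cst.
  by move=> a x y; rewrite /= scaler0 addr0.
move=> a f g /dual_predP[fl fc] /dual_predP[gl gc]; apply/dual_predP; split.
  move=> b x y; rewrite /= !fctE fl gl !scalerDr !scalerA mulrC -!addrA.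
  by congr (_ + _); rewrite addrCA.
move=> x; apply: cvgD; last exact: gc.
by apply: cvgZr; exact: fc.
Qed.

HB.instance Definition _ := GRing.isSubmodClosed.Build R (X -> R^o) dual_pred
  (GRing.submod_closed_semi dual_submod_closed).

Record dual := Dual { dual_fun :> X -> R^o; _ : dual_fun \in dual_pred }.
Implicit Types f g : dual.

HB.instance Definition _ := [isSub of dual for dual_fun].
HB.instance Definition _ := [Choice of dual by <:].
HB.instance Definition _ := [SubChoice_isSubLmodule of dual by <:].

Lemma dual_linear (f : dual) : linear f.
Proof. by case: f => f /= /dual_predP[]. Qed.

HB.instance Definition _ (f : dual) :=
  GRing.isLinear.Build R X R^o *:%R (dual_fun f) (dual_linear f).

Lemma dual_continuous (f : dual) : continuous f.
Proof. by case: f => f /= /dual_predP[]. Qed.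

Definition opnorm (f : dual) : R :=
  sup [set `|f x| | x in [set x : X | `|x| <= 1]].

Lemma opnorm_has_sup f :
  has_sup [set `|f x| | x in [set x : X | `|x| <= 1]].
Proof.
split; first by exists `|f 0|; exists 0 => //=; rewrite normr0.
have /linear_bounded_continuous/bounded_funP/(_ 1)[M fM] := @dual_continuous f.
by exists M => _ [x /= x1 <-]; exact: fM.
Qed.

Lemma opnorm_le f x : `|f x| <= opnorm f * `|x|.
Proof.
have [->|x0] := eqVneq x 0; first by rewrite linear0 !normr0 mulr0.
rewrite -ler_pdivrMr ?normr_gt0//; apply: sup_ubound.
  by case: (opnorm_has_sup f).
exists (`|x|^-1 *: x) => /=; first by rewrite normfZV.
by rewrite linearZ/= normrZ normfV normr_id mulrC.
Qed.

Lemma opnorm_le_bound f M : (forall x, `|x| <= 1 -> `|f x| <= M) ->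
  opnorm f <= M.
Proof.
move=> fM; apply: ge_sup; first by case: (opnorm_has_sup f).
by move=> _ [x /= x1 <-]; exact: fM.
Qed.

Lemma opnorm_ge0 f : 0 <= opnorm f.
Proof.
apply: sup_ubound; first by case: (opnorm_has_sup f).
by exists 0; rewrite /= ?linear0 normr0.
Qed.

Let opnormD f g : opnorm (f + g) <= opnorm f + opnorm g.
Proof.
apply: opnorm_le_bound => x x1.
rewrite (le_trans (ler_normD _ _))// lerD//.
  by rewrite (le_trans (opnorm_le _ _))// ler_piMr// opnorm_ge0.
by rewrite (le_trans (opnorm_le _ _))// ler_piMr// opnorm_ge0.
Qed.

Let opnorm_scale_le (l : R) f : opnorm (l *: f) <= `|l| * opnorm f.
Proof.
apply: opnorm_le_bound => x x1.
rewrite [_ x](_ : _ = l *: f x)// normrZ ler_wpM2l//.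
by rewrite (le_trans (opnorm_le _ _))// ler_piMr// opnorm_ge0.
Qed.

Let opnormZ (l : R) f : opnorm (l *: f) = `|l| * opnorm f.
Proof.
apply/eqP; rewrite eq_le opnorm_scale_le/=.
have [->|l0] := eqVneq l 0; first by rewrite normr0 mul0r opnorm_ge0.
rewrite -ler_pdivlMl ?normr_gt0// -normfV (le_trans _ (opnorm_scale_le _ _))//.
by rewrite scalerA mulVf// scale1r.
Qed.

Let opnorm_eq0 f : opnorm f = 0 -> f = 0.
Proof.
move=> f0; apply/val_inj/funext => x /=.
by apply/eqP; rewrite -normr_le0 (le_trans (opnorm_le _ _))// f0 mul0r.
Qed.

HB.instance Definition _ :=
  Lmodule_isNormed.Build R dual opnormD opnormZ opnorm_eq0.

End Dual.

Section CanonicalEmbedding.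
Context {R : realType} (X : normedModType R).

Lemma evaluation_dual (x : X) : (fun f : dual X => f x : R^o) \in @dual_pred R (dual X).
Proof.
apply/dual_predP.
have ev_linear : linear (fun f : dual X => f x : R^o) by [].
pose ev := GRing.isLinear.Build R (dual X) R^o *:%R _ ev_linear.
pose evl : {linear dual X -> R^o} := HB.pack (fun f : dual X => f x : R^o) ev.
split => //; apply/(@linear_bounded_continuous _ _ _ evl)/bounded_funP => r.
exists (r * `|x|) => f fr; rewrite (le_trans (opnorm_le _ _))//.
by rewrite ler_wpM2r.
Qed.

Definition canonical_embedding (x : X) : dual (dual X) :=
  Dual (evaluation_dual x).

End CanonicalEmbedding.

Section Topologies.
Context {R : realType} (X : normedModType R).

(* The types weak, weakstar and mackey carry the initial topologies for the
   pointwise evaluations (weak, weakstar) and for uniform convergence on each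
   weakly compact subset of X (mackey), instead of the norm topology. *)
Definition weak : Type :=
  initial_topology
    ((fun (x : X) (f : dual X) => f x) : X -> {ptws dual X -> R^o}).

HB.instance Definition _ := Topological.copy weak
  (initial_topology
    ((fun (x : X) (f : dual X) => f x) : X -> {ptws dual X -> R^o})).

Definition weakly_compact (K : set X) : Prop := compact (K : set weak).

Definition weakstar : Type :=
  initial_topology ((fun f : dual X => f : X -> R^o) : _ -> {ptws X -> R^o}).

HB.instance Definition _ := Topological.copy weakstar
  (initial_topology ((fun f : dual X => f : X -> R^o) : _ -> {ptws X -> R^o})).

Definition mackey : Type :=
  initial_topology ((fun f : dual X => f : X -> R^o) :
    _ -> {family weakly_compact, X -> R^o}).

HB.instance Definition _ := Topological.copy mackey
  (initial_topology ((fun f : dual X => f : X -> R^o) :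
    _ -> {family weakly_compact, X -> R^o})).

End Topologies.

(* The condition on the blocks is max (I k) < min (I k.+1); the blocks are
   nonempty because the coefficients over each of them sum to 1. *)
Definition convex_block_subseq (R : realType) (V : lmodType R)
    (x y : nat -> V) : Prop :=
  exists (I : nat -> {fset nat}) (a : nat -> R),
    [/\ forall k m n, m \in I k -> n \in I k.+1 -> (m < n)%N,
        forall n, 0 <= a n,
        forall k, \sum_(n <- I k) a n = 1
      & forall k, y k = \sum_(n <- I k) a n *: x n].

Section BanachProperties.
Context {R : realType} (X : completeNormedModType R).

Definition reflexive_space : Prop :=
  forall F : dual (dual X), exists x : X, canonical_embedding x = F.

Definition weakstar_convergent (u : nat -> dual X) : Prop :=
  exists f : dual X, u @ \oo --> (f : weakstar X).

Definition weakly_convergent (u : nat -> dual X) : Prop :=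
  exists f : dual X, u @ \oo --> (f : weak (dual X)).

Definition mackey_convergent (u : nat -> dual X) : Prop :=
  exists f : dual X, u @ \oo --> (f : mackey X).

Definition grothendieck_space : Prop :=
  forall u, weakstar_convergent u -> weakly_convergent u.

Definition property_K : Prop :=
  forall u, weakstar_convergent u ->
    exists2 v, convex_block_subseq u v & mackey_convergent v.

End BanachProperties.

(* Main.v *)
(* Write q : X -> X/Y. Weakly compact sets map to weakly compact sets under q,
   and when Y is reflexive every weakly compact K in X/Y is covered by the image
   of a weakly compact set of X. So if (u_n) is weak*-convergent in (X/Y)^*, a
   convex block subsequence of (u_n o q) that converges for the Mackey topology
   has a limit vanishing on Y, and the convergence passes down to X/Y.

   For (ii), let (u_n) be weak*-convergent in X^*. The restrictions to Y converge
   weakly, hence by Mazur's lemma some convex blocks v_k satisfy v_k|Y -> g in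
   norm. Hahn-Banach extensions w_k of v_k|Y - g with |w_k| -> 0, and G of g,
   give v_k = t_k o q + w_k + G with (t_k) weak*-convergent in (X/Y)^*. Blocks of
   (t_k) that converge for the Mackey topology then yield such blocks of (v_k),
   since weakly compact sets are bounded. *)
Require Import Defs.
From HB Require Import structures.
From mathcomp Require Import all_boot all_order all_algebra finmap.
From mathcomp Require Import all_classical all_reals all_analysis.
From mathcomp Require Import lra.

Set Implicit Arguments.
Unset Strict Implicit.
Unset Printing Implicit Defensive.

Import Order.TTheory GRing.Theory Num.Theory.
Import numFieldNormedType.Exports.

Local Open Scope classical_set_scope.
Local Open Scope ring_scope.

(** * Convergence in the weak, weak* and Mackey topologies *)

Section InitialTopologies.

Lemma initial_topology_cvgP (S : choiceType) (T : topologicalType) (f : S -> T)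
    (F : set_system S) (s : S) : Filter F ->
  (F --> (s : initial_topology f)) <-> (f @ F --> f s).
Proof.
move=> FF; split=> [Fs|Ffs].
  by move=> A /(@initial_continuous _ _ f) /Fs.
move=> A /= [_ [[B Bop <-] Bfs sBfA]].
have /Ffs FB : nbhs (f s) B by apply: open_nbhs_nbhs.
exact: filterS sBfA FB.
Qed.

Context {R : realType} (X : normedModType R).

Lemma weak_cvgP (F : set_system X) (x : X) : Filter F ->
  (F --> (x : weak X)) <-> (forall f : dual X, f @ F --> f x).
Proof.
move=> FF; apply: (iff_trans (initial_topology_cvgP _ _ FF)).
exact: pointwise_cvgP.
Qed.

Lemma weakstar_cvgP (F : set_system (dual X)) (f : dual X) : Filter F ->
  (F --> (f : weakstar X)) <-> (forall x, (fun g : dual X => g x) @ F --> f x).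
Proof.
move=> FF; apply: (iff_trans (initial_topology_cvgP _ _ FF)).
exact: pointwise_cvgP.
Qed.

Lemma mackey_cvgP (F : set_system (dual X)) (f : dual X) : Filter F ->
  (F --> (f : mackey X)) <->
  (forall K, weakly_compact K -> forall e, 0 < e ->
    F [set g : dual X | forall x, K x -> `|f x - g x| < e]).
Proof.
move=> FF; apply: (iff_trans (initial_topology_cvgP _ _ FF)).
apply: (iff_trans (fam_cvgP _ _ _)); split=> H K wK.
  move=> e e0.
  have := H K wK [set h : X -> R^o | forall x, K x -> `|f x - h x| < e].
  apply; apply/uniform_nbhs.
  exists [set p : R^o * R^o | `|p.1 - p.2| < e]; split; last by [].
  by rewrite -entourage_ballE; exists e.
move=> A /uniform_nbhs[E [entE EA]].
move: entE; rewrite -entourage_ballE => -[e /= e0 eE].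
refine (@filterS _ F FF _ _ _ (H K wK e e0)) => g gK.
by apply: EA => x Kx; apply: eE; exact: gK.
Qed.

End InitialTopologies.

(** * The Hahn-Banach theorem by way of minimal sublinear functionals *)

Section HahnBanach.
Context {R : realType} {V : lmodType R}.
Implicit Types p q : V -> R.

Definition sublinear p : Prop :=
  (forall x y, p (x + y) <= p x + p y) /\
  (forall t x, 0 <= t -> p (t *: x) = t * p x).

Lemma sublinear0 p : sublinear p -> p 0 = 0.
Proof. by move=> [_ pZ]; rewrite -(scale0r 0) pZ// mul0r. Qed.

Lemma sublinear_opp p x : sublinear p -> - p (- x) <= p x.
Proof.
move=> sp; rewrite -subr_ge0 opprK -(sublinear0 sp) -(subrr x).
by case: sp => pD _; exact: pD.
Qed.

(** Applying the inequality to [t^-1] gives its converse. For [t = 0], subadditivity gives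
    [0 <= p 0], and the factor [2^-1] gives [p 0 <= p 0 / 2]. *)
Lemma sublinearP p : (forall x y, p (x + y) <= p x + p y) ->
  (forall t x, 0 < t -> p (t *: x) <= t * p x) -> sublinear p.
Proof.
move=> pD pZ; split=> // t x; rewrite le_eqVlt => /predU1P[<-|t0].
  have := pD 0 0; rewrite addr0 -subr_ge0 addrK => p0.
  have := pZ 2^-1 0; rewrite scaler0 scale0r mul0r invr_gt0 ltr0n => /(_ isT).
  by move=> p0_half; lra.
apply/eqP; rewrite eq_le pZ//= -ler_pdivlMl//.
have /(pZ _ (t *: x)) : 0 < t^-1 by rewrite invr_gt0.
by rewrite scalerA mulVf ?gt_eqF// scale1r.
Qed.

(** Common source of the sublinear functionals below: lower bounds of chains, and the infima behind
    additivity, extension and separation. Since [i] and [j] vary independently on the right, the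
    infimum can be taken over each in turn. *)
Lemma sublinear_inf (I : Type) (D : set I) (phi : I -> V -> R) :
  D !=set0 ->
  (forall x, exists l, forall i, D i -> l <= phi i x) ->
  (forall i j x y, D i -> D j ->
     exists2 k, D k & phi k (x + y) <= phi i x + phi j y) ->
  (forall t i x, 0 < t -> D i ->
     exists2 k, D k & phi k (t *: x) <= t * phi i x) ->
  exists m : V -> R, [/\ sublinear m, (forall i x, D i -> m x <= phi i x) &
    forall x l, (forall i, D i -> l <= phi i x) -> l <= m x].
Proof.
move=> [i0 Di0] lb phiD phiZ; pose m x := inf [set phi i x | i in D].
have hm x : has_inf [set phi i x | i in D].
  split; first by exists (phi i0 x), i0.
  by have [l lP] := lb x; exists l => _ [i Di <-]; exact: lP.
have m_le i x : D i -> m x <= phi i x.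
  by move=> Di; apply: ge_inf; [case: (hm x)|exists i].
have m_ge x l : (forall i, D i -> l <= phi i x) -> l <= m x.
  by move=> H; apply: lb_le_inf; [case: (hm x)|move=> _ [i Di <-]; exact: H].
exists m; split => //; apply: sublinearP.
  move=> x y; rewrite -lerBlDr; apply: (m_ge) => i Di; rewrite lerBlDl.
  rewrite -lerBlDr; apply: m_ge => j Dj; rewrite lerBlDl.
  by have [k Dk kP] := phiD i j x y Di Dj; exact: le_trans (m_le _ _ Dk) _.
move=> t x t0; rewrite -ler_pdivrMl//; apply: m_ge => i Di.
rewrite ler_pdivrMl//; have [k Dk kP] := phiZ t i x t0 Di.
exact: le_trans (m_le _ _ Dk) kP.
Qed.

(* The functional [x |-> inf_(t >= 0) (p (x + t z) - t p z)] is sublinear and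
   below [p]; minimality of [p] forces equality, i.e. additivity. *)
Lemma minimal_sublinear_additive p : sublinear p ->
  (forall q, sublinear q -> (forall x, q x <= p x) -> forall x, p x <= q x) ->
  forall x z, p (x + z) = p x + p z.
Proof.
move=> sp pmin x z; have [pD pZ] := sp.
have [||||m [sm m_le _]] := @sublinear_inf R [set t | 0 <= t]
    (fun t y => p (y + t *: z) - t * p z).
- by exists 0 => /=.
- move=> y; exists (- p (- y)) => t /= t0.
  rewrite lerBrDr addrC lerBlDr -pZ//.
  by have := pD (y + t *: z) (- y); rewrite addrAC subrr add0r.
- move=> t s y w /= t0 s0; exists (t + s); first exact: addr_ge0.
  rewrite scalerDl mulrDl (addrACA y) opprD [leRHS]addrACA.
  by apply: lerD => //; exact: pD.
- move=> s t y s0 /= t0; exists (s * t); first by rewrite mulr_ge0// ltW.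
  by rewrite mulrBr -(pZ _ _ (ltW s0)) scalerDr scalerA mulrA.
have mp y : m y <= p y.
  by have := m_le 0 y (lexx 0); rewrite scale0r addr0 mul0r subr0.
(* The inequality left is [p x <= p (x + z) - p z]; minimality gives [p x <= m x], and the index
   [t = 1] bounds [m x]. *)
apply/eqP; rewrite eq_le pD/= -lerBrDr.
apply: (le_trans (pmin m sm mp x)).
by have := m_le 1 x ler01; rewrite scale1r mul1r.
Qed.

(** Zorn's lemma yields a minimal sublinear functional below [p]. It is additive, hence odd, and
    positive homogeneity then extends to all scalars. *)
Theorem hahn_banach p : sublinear p ->
  exists f : V -> R^o, linear f /\ forall x, f x <= p x.
Proof.
move=> sp.
pose T := {q : V -> R | sublinear q /\ forall x, q x <= p x}.
(* The order is reversed, so that a maximal element is a minimal functional. *)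
pose le_ (s t : T) := `[< forall x, sval t x <= sval s x >].
have p0 : T by exists p; split.
have [||A Atot|[f [sf fp]] fmax] := @ZL_preorder T p0 le_.
- by move=> t; apply/asboolP.
- by move=> r s t /asboolP rs /asboolP st; apply/asboolP => x; exact: le_trans.
- have [->|/set0P[t0 At0]] := eqVneq A set0; first by exists p0.
  have [||||q [sq q_le _]] := @sublinear_inf T A sval; first by exists t0.
  + move=> x; exists (- p (- x)) => -[q [sq qp]] _ /=.
    by rewrite (le_trans _ (sublinear_opp x sq))// lerN2.
  + move=> s t x y As At.
    (* In a chain, the smaller of the two functionals serves as the common index. *)
    have {Atot} [/asboolP st|/asboolP ts] := Atot s t As At;
      [exists t|exists s] => //.
      have [[tD _] _] := svalP t; rewrite (le_trans (tD _ _))// lerD//; exact: st.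
    have [[sD _] _] := svalP s; rewrite (le_trans (sD _ _))// lerD//; exact: ts.
  + move=> t s x t_gt0 As; exists s => //.
    by have [[_ sZ] _] := svalP s; rewrite sZ// ltW.
  have qp x : q x <= p x.
    by rewrite (le_trans (q_le _ _ At0))//; have [_] := svalP t0.
  by exists (exist _ q (conj sq qp)) => s As; apply/asboolP => x /=; exact: q_le.
have fD : forall x z, f (x + z) = f x + f z.
  apply: minimal_sublinear_additive => // q sq qf.
  have qp x : q x <= p x by exact: le_trans (fp x).
  have := fmax (exist _ q (conj sq qp)).
  by move=> /(_ (introT (asboolP _) qf)) /asboolP.
have fN x : f (- x) = - f x.
  by apply/eqP; rewrite -subr_eq0 opprK -fD addNr sublinear0.
exists f; split=> // a x y; rewrite fD; congr (_ + _); have [_ fZ] := sf.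
have [a0|/ltW a0] := leP 0 a; first exact: fZ.
by rewrite -[a *: x]opprK -scaleNr fN fZ ?oppr_ge0// mulNr opprK.
Qed.

End HahnBanach.

(** * Bounded linear functionals as elements of the dual *)

Section DualTools.
Context {R : realType} (X : normedModType R).

Lemma dual_le (f : dual X) x : `|f x| <= `|f| * `|x|.
Proof. exact: opnorm_le. Qed.

Lemma dual_norm_le (f : dual X) M : 0 <= M ->
  (forall x, `|f x| <= M * `|x|) -> `|f| <= M.
Proof.
move=> M0 fM; apply: opnorm_le_bound => x x1.
by rewrite (le_trans (fM x))// ler_piMr.
Qed.

Lemma bounded_linear_dual (f : X -> R^o) M : 0 <= M -> linear f ->
  (forall x, `|f x| <= M * `|x|) ->
  exists2 g : dual X, (forall x, g x = f x) & `|g| <= M.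
Proof.
move=> M0 fl fM.
pose fL : {linear X -> R^o} := HB.pack f (GRing.isLinear.Build _ _ _ _ _ fl).
have fdual : f \in @dual_pred R X.
  apply/dual_predP; split => //.
  apply/(@linear_bounded_continuous _ _ _ fL)/bounded_funP => r.
  by exists (M * r) => x xr; rewrite (le_trans (fM x))// ler_wpM2l.
by exists (Dual fdual) => //; exact: dual_norm_le.
Qed.

(** A one-sided bound suffices: at [- x] it bounds [f x] from below. *)
Lemma dominated_linear_dual (f : X -> R^o) M : 0 <= M -> linear f ->
  (forall x, f x <= M * `|x|) ->
  exists2 g : dual X, (forall x, g x = f x) & `|g| <= M.
Proof.
move=> M0 fl fM; apply: bounded_linear_dual => // x.
pose fL : {linear X -> R^o} := HB.pack f (GRing.isLinear.Build _ _ _ _ _ fl).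
rewrite ler_norml fM andbT lerNl -[- f x](linearN fL) -(normrN x).
exact: fM.
Qed.

End DualTools.

(** * Extension, separation and norming functionals *)

Section HahnBanachNormed.
Context {R : realType} (X : normedModType R).

Lemma dual_extension (Y : closedSubspace X) (g : dual (csubType Y)) :
  exists2 f : dual X, (forall y : csubType Y, f (csub_val y) = g y) &
    `|f| <= `|g|.
Proof.
(* A linear functional below [inf_y (g y + |g| |x - y|)] is below [g] on [Y],
   hence equal to [g] there by linearity. *)
pose phi (y : csubType Y) x := g y + `|g| * `|x - csub_val y|.
have gM y : - (`|g| * `|y|) <= g y.
  by have := dual_le g y; rewrite ler_norml => /andP[].
have phi0 y x : - (`|g| * `|x|) <= phi y x.
  rewrite /phi -lerBlDr -opprD -mulrDr (le_trans _ (gM y))// lerN2 ler_wpM2l//.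
  have -> : `|y| = `|x - (x - csub_val y)| by rewrite opprB addrC subrK.
  exact: ler_normB.
have [||||p [sp p_le _]] := @sublinear_inf R X _ setT phi.
- by exists 0.
- by move=> x; exists (- (`|g| * `|x|)) => y _; exact: phi0.
- move=> y z a b _ _; exists (y + z) => //.
  rewrite /phi linearD/= [leRHS]addrACA lerD// -mulrDr ler_wpM2l//.
  by rewrite opprD (addrACA a) ler_normD.
- move=> t y x t0 _; exists (t *: y) => //.
  rewrite /phi linearZ/= -scalerBr normrZ gtr0_norm// mulrDr.
  by rewrite mulrCA.
have [f0 [fl fp]] := hahn_banach sp.
have [f ff0 fg] : exists2 f : dual X, (forall x, f x = f0 x) & `|f| <= `|g|.
  apply: dominated_linear_dual => // x; rewrite (le_trans (fp x))//.
  by rewrite (le_trans (p_le 0 x I))// /phi linear0 add0r subr0.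
exists f => // y; have fy_le z : f (csub_val z) <= g z.
  rewrite ff0 (le_trans (fp _))// (le_trans (p_le z _ I))//.
  by rewrite /phi subrr normr0 mulr0 addr0.
apply/eqP; rewrite eq_le fy_le/= -lerN2 -!linearN.
exact: (fy_le (- y)).
Qed.

Lemma dual_separation (C : set X) (d : R) : 0 < d -> C !=set0 ->
  (forall x y t, C x -> C y -> 0 <= t <= 1 -> C (t *: x + (1 - t) *: y)) ->
  (forall x, C x -> d <= `|x|) ->
  exists2 f : dual X, `|f| <= 1 & forall x, C x -> d <= f x.
Proof.
move=> d0 [c0 Cc0] Cconv Cd.
(* A linear functional below [x |-> inf_(t >= 0, c in C) (|x - t c| - t d)] is
   at most [- d] on [C] (take [t = 1], [x = c]) and has norm at most 1. *)
pose D := [set i : R * X | 0 <= i.1 /\ C i.2].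
pose phi (i : R * X) x := `|x - i.1 *: i.2| - i.1 * d.
have [||||p [sp p_le _]] := @sublinear_inf R X _ D phi.
- by exists (0, c0).
- move=> x; exists (- `|x|) => -[t c] [/= t0 Cc]; rewrite /phi/=.
  have : t * d <= `|t *: c| by rewrite normrZ ger0_norm// ler_wpM2l// Cd.
  have := ler_normB x (x - t *: c); rewrite opprB addrC subrK.
  by lra.
- move=> [t c] [s e] x y [/= t0 Cc] [/= s0 Ce].
  (* When [t = s = 0] the weights [t / (t + s)] are meaningless, but any point of [C] will do.
     Otherwise [t c + s e] is [t + s] times a convex combination of [c] and [e]. *)
  have [ts0|ts0] := eqVneq (t + s) 0.
    exists (0, c); first by split.
    have -> : t = 0 by apply/eqP; rewrite eq_le t0 andbT -ts0 lerDl.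
    have -> : s = 0 by apply/eqP; rewrite eq_le s0 andbT -ts0 lerDr.
    by rewrite /phi/= !scale0r !mul0r !subr0 ler_normD.
  have ts_gt0 : 0 < t + s by rewrite lt_def ts0 addr_ge0.
  exists (t + s, (t / (t + s)) *: c + (1 - t / (t + s)) *: e).
    split; first exact: addr_ge0.
    apply: Cconv => //; rewrite divr_ge0 ?addr_ge0//=.
    by rewrite ler_pdivrMr// mul1r lerDl.
  rewrite /phi/= mulrDl opprD [leRHS]addrACA lerD//.
  rewrite scalerDr !scalerA mulrBr mulr1 mulrC divfK// (addrC t) addrK.
  by rewrite opprD (addrACA x) ler_normD.
- move=> t [s c] x t0 [/= s0 Cc]; exists (t * s, c).
    by split => //=; rewrite mulr_ge0// ltW.
  by rewrite /phi/= -scalerA -scalerBr normrZ gtr0_norm// mulrBr mulrA.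
have [f0 [fl fp]] := hahn_banach sp.
have [f ff0 f1] : exists2 f : dual X, (forall x, f x = f0 x) & `|f| <= 1.
  apply: dominated_linear_dual => // x; rewrite (le_trans (fp x))//.
  have D0 : D (0, c0) by split.
  rewrite (le_trans (p_le _ x D0))//.
  by rewrite /phi/= scale0r subr0 mul0r subr0 mul1r.
exists (- f) => [|x Cx]; first by rewrite normrN.
rewrite [leRHS](_ : _ = - f x)// ff0 lerNr (le_trans (fp x))//.
have D1 : D (1, x) by split => //=.
rewrite (le_trans (p_le _ x D1))//.
by rewrite /phi/= scale1r subrr normr0 sub0r mul1r.
Qed.

(** For nonzero [x], this is separation of the singleton of [x] from [0] at distance [|x|]. *)
Lemma dual_norming (x : X) : exists2 f : dual X, `|f| <= 1 & f x = `|x|.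
Proof.
have [->|x0] := eqVneq x 0.
  by exists 0; rewrite ?normr0 ?linear0.
have [||||f f1 fx] := @dual_separation [set x] `|x|.
- by rewrite normr_gt0.
- by exists x.
- by move=> _ _ t -> -> _ /=; rewrite -scalerDl addrC subrK scale1r.
- by move=> _ ->.
exists f => //; apply/eqP; rewrite eq_le fx// andbT.
rewrite (le_trans (ler_norm _))// (le_trans (dual_le _ _))//.
by rewrite ler_piMl.
Qed.

End HahnBanachNormed.

(** * Completeness of the dual *)

Section DualComplete.
Context {R : realType} (X : normedModType R).

Lemma dual_pointwise_limit_le (F : set_system (dual X)) (f l : dual X) x M :
  ProperFilter F -> (fun g : dual X => g x) @ F --> l x ->
  F [set g : dual X | `|f - g| <= M] -> `|f x - l x| <= M * `|x|.
Proof.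
move=> FF /cvgrPdist_lt Fl FM; apply/ler_addgt0Pr => e e0.
have [g [/= lg fg]] := filter_ex (filterI (Fl e e0) FM).
rewrite (le_trans (ler_distD (g x) _ _))// lerD//; last by rewrite distrC ltW.
rewrite [X in `|X|](_ : _ = (f - g) x)// (le_trans (dual_le _ _))//.
by rewrite ler_wpM2r.
Qed.

(** The pointwise limit is linear and bounded, and the Cauchy condition makes the convergence
    uniform on the unit ball. Completeness allows the uniform boundedness principle to be applied
    with the dual as domain. *)
Lemma dual_complete (F : set_system (dual X)) :
  ProperFilter F -> cauchy F -> cvg F.
Proof.
move=> FF /cauchyP Fc.
(* Non-strict bounds are used because they survive pointwise limits. *)
have Fc' e : 0 < e -> exists p : dual X, F [set g : dual X | `|p - g| <= e].
  move=> e0; have [p Fp] := Fc e e0; exists p; apply: filterS Fp => g.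
  by rewrite -ball_normE => /ltW.
have [l0 l0P] : {l0 : X -> R^o & forall x, (fun g : dual X => g x) @ F --> l0 x}.
  apply: (@choice _ _ (fun x l => (fun g : dual X => g x : R^o) @ F --> l)) => x.
  apply/cvg_ex/cauchy_cvgP/cauchyP => e e0.
  have x1 : 0 < `|x| + 1 by rewrite ltr_wpDl.
  have [p Fp] := Fc' (e / (`|x| + 1)) (divr_gt0 e0 x1).
  exists (p x : R^o); refine (@filterS _ F _ _ _ _ Fp) => g pg /=.
  rewrite -ball_normE/=.
  rewrite [X in `|X|](_ : _ = (p - g) x)// (le_lt_trans (dual_le _ _))//.
  rewrite (le_lt_trans (ler_wpM2r _ pg))// mulrAC ltr_pdivrMr// ltr_pM2l//.
  by rewrite ltrDl.
have l0_linear : linear l0.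
  move=> a x y; apply: (cvg_unique (@norm_hausdorff R R^o) (l0P _)).
  rewrite (_ : (fun g : dual X => g (a *: x + y)) =
      (fun g : dual X => a *: (g x : R^o) + g y)).
    by apply: cvgD => //; exact: cvgZr.
  by apply/funext => g; rewrite linearP.
(* Members of [F] near [p] have norm at most [|p| + 1], a bound that the limit inherits. *)
have [p Fp] := Fc' 1 ltr01.
have l0_bound x : `|l0 x| <= (`|p| + 1) * `|x|.
  have /cvgrPdist_lt Fl := l0P x; apply/ler_addgt0Pr => e e0.
  have [g [/= lg fg]] := filter_ex (filterI (Fl e e0) Fp).
  have := ler_distD (g x) (l0 x) 0; rewrite !subr0 => /le_trans -> //.
  rewrite addrC lerD//; last exact: ltW.
  rewrite (le_trans (dual_le _ _))// ler_wpM2r//.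
  have := ler_normB p (p - g); rewrite opprB addrC subrK => /le_trans->//.
  by rewrite lerD2l.
have [l ll0 _] :=
  bounded_linear_dual (addr_ge0 (normr_ge0 p) ler01) l0_linear l0_bound.
apply/cvg_ex; exists l; apply/cvgrPdist_lt => e e0.
have e3 : 0 < e / 3 by rewrite divr_gt0.
have [r Fr] := Fc' _ e3.
have rl : `|r - l| <= e / 3.
  apply: dual_norm_le => [|x]; first exact: ltW.
  apply: (@dual_pointwise_limit_le F) => //.
  by rewrite ll0; exact: l0P.
apply: filterS Fr => g rg.
rewrite (le_lt_trans (ler_distD r _ _))// (distrC l).
have : e / 3 + e / 3 < e by lra.
by apply: le_lt_trans; exact: lerD.
Qed.

HB.instance Definition _ := Uniform_isComplete.Build (dual X) dual_complete.

End DualComplete.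

(** * Images and boundedness of weakly compact sets *)

Section WeaklyCompact.
Context {R : realType}.

Lemma weak_dual_continuous (X : normedModType R) (f : dual X) :
  continuous (f : weak X -> R^o).
Proof.
move=> x; have /weak_cvgP : nbhs (x : weak X) --> (x : weak X) by exact: cvg_id.
by apply.
Qed.

(** The hypothesis that functionals pull back along [h] amounts to weak-to-weak continuity. *)
Lemma weakly_compact_image (X Z : normedModType R) (h : X -> Z) (K : set X) :
  (forall f : dual Z, exists g : dual X, forall x, g x = f (h x)) ->
  weakly_compact K -> weakly_compact (h @` K).
Proof.
move=> hP wK; apply: (@continuous_compact (weak X) (weak Z) h) => //.
apply: continuous_subspaceT => x.
have FF : Filter (h @ nbhs (x : weak X)) by exact: fmap_filter.
apply/(weak_cvgP _ FF) => f; have [g gP] := hP f.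
rewrite -gP (_ : f @ (h @ _) = g @ nbhs (x : weak X)).
  exact: weak_dual_continuous.
have -> : (g : X -> R^o) = f \o h by apply/funext => z; rewrite /= gP.
by rewrite fmap_comp.
Qed.

(** Uniform boundedness is applied to the evaluations at points of [K], seen as functionals on the
    dual. They are pointwise bounded because each [f] maps [K] to a compact set of scalars; a
    norming functional then recovers [|x|]. *)
Lemma weakly_compact_bounded (X : normedModType R) (K : set X) :
  weakly_compact K -> exists2 M, 0 <= M & forall x, K x -> `|x| <= M.
Proof.
move=> wK.
have [|f|M MP] := @Banach_Steinhauss R (dual X) R^o
    [set (fun f : dual X => f x : R^o) | x in K] _ _ 1.
- move=> _ [x Kx <-]; split => //.
  move=> r; exists (r * `|x|) => f fr; rewrite (le_trans (dual_le _ _))//.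
  by rewrite ler_wpM2r.
- have : compact ((f : weak X -> R^o) @` K).
    apply: (@continuous_compact (weak X) R^o f) => //.
    by apply: continuous_subspaceT; exact: weak_dual_continuous.
  move=> /compact_bounded[M [_ MP]]; exists (M + 1) => _ [x Kx <-].
  by apply: (MP (M + 1)); [rewrite ltrDl|exists x].
(* If [K] is empty, nothing forces [M] to be nonnegative. *)
exists (Num.max M 0); first by rewrite le_max lexx orbT.
move=> x Kx; have [f f1 fx] := dual_norming x.
rewrite le_max -fx -[X in X <= M]ger0_norm ?fx// -fx; apply/orP; left.
by apply: (MP (fun f : dual X => f x : R^o)) => //; exists x.
Qed.

End WeaklyCompact.

(** * Duality of subspaces and quotients, and lifting of weakly compact sets *)

Section SubspaceQuotientDuality.
Context {R : realType} (X : normedModType R) (Y : closedSubspace X).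

Lemma dual_restrict_subproof (f : dual X) :
  (fun y : csubType Y => f (csub_val y)) \in @dual_pred R (csubType Y).
Proof.
have fl : linear (fun y : csubType Y => f (csub_val y) : R^o).
  by move=> a x y; rewrite -linearP.
have [g gf _] := bounded_linear_dual (normr_ge0 f) fl
  (fun y : csubType Y => dual_le f (csub_val y)).
by rewrite (_ : (fun y => _) = g) ?(valP g)//; apply/funext => y; rewrite gf.
Qed.

Definition dual_restrict (f : dual X) : dual (csubType Y) :=
  Dual (dual_restrict_subproof f).

Lemma dual_pullback_subproof (t : dual (quotient_space Y)) :
  (fun x : X => t (qproj Y x)) \in @dual_pred R X.
Proof.
have tl : linear (fun x : X => t (qproj Y x) : R^o).
  move=> a x y; rewrite -linearP; congr (t _).
  by rewrite raddfD; congr (_ + _); exact: qproj_scale.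
have tM (x : X) : `|t (qproj Y x)| <= `|t| * `|x|.
  by rewrite (le_trans (dual_le _ _))// ler_wpM2l//; exact: qnorm_le.
have [g gf _] := bounded_linear_dual (normr_ge0 t) tl tM.
by rewrite (_ : (fun x => _) = g) ?(valP g)//; apply/funext => x; rewrite gf.
Qed.

Definition dual_pullback (t : dual (quotient_space Y)) : dual X :=
  Dual (dual_pullback_subproof t).

(** Vanishing on [Y] makes the value independent of the representative; representatives of nearly
    minimal norm give the bound [|f|]. *)
Lemma dual_factor (f : dual X) : (forall y : csubType Y, f (csub_val y) = 0) ->
  exists t, dual_pullback t = f.
Proof.
move=> fY; pose t0 (z : quotient_space Y) : R^o :=
  f (repr (z : Quotient.quot (csub_pred Y))).
have t0q x : t0 (qproj Y x) = f x.
  apply/eqP; rewrite -subr_eq0 -linearB; apply/eqP.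
  have /qproj_eq xY := qproj_repr (qproj Y x).
  exact: (fY (CSub xY)).
have t0l : linear t0.
  move=> a z w; have [x <-] := qproj_surj z; have [y <-] := qproj_surj w.
  rewrite [X in X + _](esym (qproj_scale Y a x)) -raddfD !t0q.
  exact: linearP.
have t0M z : `|t0 z| <= `|f| * `|z|.
  apply/ler_addgt0Pr => e e0.
  have f1 : 0 < `|f| + 1 by rewrite ltr_wpDl.
  have /qnorm_lt[x <- xz] : qnorm z < `|z| + e / (`|f| + 1).
    by rewrite ltrDl divr_gt0.
  rewrite t0q (le_trans (dual_le _ _))// (le_trans (ler_wpM2l _ (ltW xz)))//.
  rewrite mulrDr lerD2l mulrCA ler_piMr ?(ltW e0)//.
  by rewrite ler_pdivrMr// mul1r lerDl.
have [t tt0 _] := bounded_linear_dual (normr_ge0 f) t0l t0M.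
by exists t; apply/val_inj/funext => x /=; rewrite tt0 t0q.
Qed.

(** Compactness gives a cluster point. For a neighbourhood [B] of it, the ultrafilter contains the
    preimage of [B] or of its complement, and the latter would contradict clustering. *)
Lemma ultra_compact_cvg (T : Type) (U : topologicalType) (g : T -> U)
    (F : set_system T) (A : set U) : UltraFilter F -> compact A ->
  F (g @^-1` A) -> exists2 l, A l & g @ F --> l.
Proof.
move=> UF cA FA; have [l [Al Fl]] := cA (g @ F) _ FA.
exists l => // B Bl; rewrite /= nbhs_filterE.
have [//|FnB] := in_ultra_setVsetC (g @^-1` B) UF.
by have [z []] := Fl (~` B) B FnB Bl.
Qed.

(* The lift is [q^-1(K)] intersected with a multiple of the unit ball, the
   latter written as a polar so that it is visibly weakly closed. An ultrafilter
   on it converges weak* to some [phi] in the bidual of [X], and if [x0] lifts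
   its weak limit in [K], then [phi - x0] annihilates the functionals vanishing
   on [Y], so that it comes from the bidual of [Y], which is [Y]. *)
Lemma weakly_compact_lift (K : set (quotient_space Y)) :
  (forall F : dual (dual (csubType Y)),
     exists y : csubType Y, canonical_embedding y = F) ->
  weakly_compact K ->
  exists2 S : set X, weakly_compact S & K `<=` qproj Y @` S.
Proof.
move=> reflY wK; have [M M0 KM] := weakly_compact_bounded wK.
have M1 : 0 <= M + 1 by rewrite addr_ge0.
pose S := [set x : X | K (qproj Y x) /\
  forall f : dual X, `|f x| <= (M + 1) * `|f|].
exists S; last first.
  (* The quotient norm need not be attained, hence the radius [M + 1] instead of [M]. *)
  move=> z Kz; have /qnorm_lt[x xz xM] : qnorm z < M + 1.
    by rewrite (le_lt_trans (KM z Kz))// ltrDl.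
  exists x => //; split; first by rewrite xz.
  by move=> f; rewrite (le_trans (dual_le _ _))// mulrC ler_wpM2r// ltW.
rewrite /weakly_compact compact_ultra => F UF FS.
have FF : ProperFilter F by exact: ultra_proper.
have [phi0 phi0P] : {phi : dual X -> R^o & forall f : dual X,
    `|phi f| <= (M + 1) * `|f| /\ (f : X -> R^o) @ F --> phi f}.
  apply: (@choice _ _ (fun (f : dual X) l => `|l| <= (M + 1) * `|f| /\
    (f : X -> R^o) @ F --> (l : R^o))) => f.
  have [|l lM fl] := @ultra_compact_cvg X R^o f F
    `[- ((M + 1) * `|f|), (M + 1) * `|f|]%classic UF (@segment_compact _ _ _).
    apply: filterS FS => x [_ /(_ f)] /=.
    by rewrite ler_norml in_itv.
  by exists l; split => //; move: lM; rewrite /= in_itv ler_norml.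
have phi0_linear : linear phi0.
  move=> a f g; have Rh := @norm_hausdorff R R^o.
  apply: (cvg_unique Rh (proj2 (phi0P _))).
  have [[_ fl] [_ gl]] := (phi0P f, phi0P g).
  by apply: cvgD => //; exact: cvgZr.
pose phi : {linear dual X -> R^o} :=
  HB.pack phi0 (GRing.isLinear.Build _ _ _ _ _ phi0_linear).
have [k Kk Fk] := @ultra_compact_cvg X (weak (quotient_space Y)) (qproj Y) F K
  UF wK (filterS (fun x (Sx : S x) => proj1 Sx) FS).
have [x0 x0k] := qproj_surj k.
(* Both sides are the limit along [F] of [t] composed with the quotient map. *)
have phi_pullback t : phi (dual_pullback t) = t k.
  have Rh := @norm_hausdorff R R^o.
  apply: (cvg_unique Rh (proj2 (phi0P _))).
  have FFq : Filter (qproj Y @ F) by exact: fmap_filter.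
  exact: (proj1 (weak_cvgP k FFq) Fk t).
have phi_vanish (f : dual X) :
    (forall y : csubType Y, f (csub_val y) = 0) -> phi f = f x0.
  by move=> /dual_factor[t <-]; rewrite phi_pullback /= x0k.
have [ext extP] : {ext : dual (csubType Y) -> dual X & forall g,
    (forall y : csubType Y, ext g (csub_val y) = g y) /\ `|ext g| <= `|g|}.
  apply: (@choice _ _ (fun (g : dual (csubType Y)) (f : dual X) =>
    (forall y : csubType Y, f (csub_val y) = g y) /\ `|f| <= `|g|)) => g.
  by have [f ? ?] := dual_extension g; exists f.
pose G0 (g : dual (csubType Y)) : R^o := phi (ext g) - ext g x0.
(* The chosen extensions [ext g] need not depend linearly on [g]. But two extensions differ by a
   functional vanishing on [Y], so [G0 g] does not depend on the choice, which makes [G0] linear. *)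
have G0E (f : dual X) (g : dual (csubType Y)) :
    (forall y : csubType Y, f (csub_val y) = g y) -> G0 g = phi f - f x0.
  move=> fg; have : phi (ext g - f) = (ext g - f) x0.
    apply: phi_vanish => y.
    rewrite [LHS](_ : _ = ext g (csub_val y) - f (csub_val y))//.
    by rewrite (proj1 (extP g)) fg subrr.
  rewrite linearB [RHS](_ : _ = ext g x0 - f x0)// => H.
  rewrite /G0 -[phi (ext g)](subrK (phi f)) H addrAC (addrC (ext g x0)).
  by rewrite addrK addrC.
have G0l : linear G0.
  move=> a g h; rewrite (G0E (a *: ext g + ext h)) => [|y].
    rewrite linearP [X in _ - X](_ : _ = a *: (ext g x0 : R^o) + ext h x0)//.
    by rewrite opprD addrACA -scalerBr.
  rewrite [LHS](_ : _ = a *: (ext g (csub_val y) : R^o) + ext h (csub_val y))//.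
  by rewrite (proj1 (extP g)) (proj1 (extP h)).
have [G GG0 _] : exists2 G : dual (dual (csubType Y)),
    (forall g, G g = G0 g) & `|G| <= M + 1 + `|x0|.
  apply: bounded_linear_dual => //; first exact: addr_ge0.
  move=> g; have [_ extg] := extP g; have [phig _] := phi0P (ext g).
  rewrite (le_trans (ler_normB _ _))// mulrDl lerD//.
    by rewrite (le_trans phig)// ler_wpM2l.
  by rewrite (le_trans (dual_le _ _))// mulrC ler_wpM2l.
have [y yG] := reflY G.
(* Here [y] represents [G], so [x0 + y] represents [phi]: it is the weak limit of [F]. *)
have phiE (f : dual X) : f (x0 + csub_val y) = phi f.
  have -> : f (x0 + csub_val y) = f x0 + G (dual_restrict f).
    by rewrite -yG; exact: linearD.
  by rewrite GG0 (G0E f)// addrC subrK.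
exists (x0 + csub_val y); split => /=.
  split; last by move=> f; rewrite phiE; exact: (proj1 (phi0P f)).
  have /qproj_eq <- : x0 - (x0 + csub_val y) \in csub_pred Y.
    by rewrite opprD addrA subrr sub0r rpredN csub_valP.
  by rewrite x0k.
apply/(weak_cvgP _ _) => f; rewrite phiE.
exact: (proj2 (phi0P f)).
Qed.

End SubspaceQuotientDuality.

(** * Convex block subsequences and Mazur's lemma *)

Section ConvexBlocks.
Context {R : realType}.

Section Increasing.
Variable I : nat -> {fset nat}.
Hypothesis I_neq0 : forall k, exists n, n \in I k.
Hypothesis I_incr : forall k m n, m \in I k -> n \in I k.+1 -> (m < n)%N.

(** The hypothesis compares consecutive blocks only; a point in each intermediate block links
    them. *)
Lemma block_lt k l m n : (k < l)%N -> m \in I k -> n \in I l -> (m < n)%N.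
Proof.
move=> + mk; elim: l n => // l IH n; rewrite ltnS leq_eqVlt => /predU1P[<-|kl] nl.
  exact: I_incr mk nl.
have [p pl] := I_neq0 l; exact: ltn_trans (IH p kl pl) (I_incr pl nl).
Qed.

Lemma block_ge k n : n \in I k -> (k <= n)%N.
Proof.
elim: k n => // k IH n nk; have [p pk] := I_neq0 k.
exact: leq_ltn_trans (IH p pk) (I_incr pk nk).
Qed.

Lemma block_inj k l n : n \in I k -> n \in I l -> k = l.
Proof.
move=> nk nl; have [kl|lk|//] := ltngtP k l.
- by have := block_lt kl nk nl; rewrite ltnn.
- by have := block_lt lk nl nk; rewrite ltnn.
Qed.

(** Convex blocks share a single coefficient sequence. Coefficients chosen block by block merge into
    one since the blocks are disjoint, with value [0] off the blocks. *)
Lemma glue_coefficients (alpha : nat -> nat -> R) :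
  (forall k n, 0 <= alpha k n) ->
  exists a : nat -> R, (forall n, 0 <= a n) /\
    forall k n, n \in I k -> a n = alpha k n.
Proof.
move=> alpha0.
have [a aP] : {a : nat -> R & forall n, 0 <= a n /\
    forall k, n \in I k -> a n = alpha k n}.
  apply: (@choice _ _ (fun n r => 0 <= r /\ forall k, n \in I k -> r = alpha k n)).
  move=> n; have [[k nk]|nI] := pselect (exists k, n \in I k).
    by exists (alpha k n); split=> // l nl; rewrite (block_inj nk nl).
  by exists 0; split=> // k nk; case: nI; exists k.
by exists a; split=> [n|k n]; have [] := aP n => // _; exact.
Qed.

End Increasing.

Lemma block_neq0 (I : nat -> {fset nat}) (a : nat -> R) :
  (forall k, \sum_(n <- I k) a n = 1) -> forall k, exists n, n \in I k.
Proof.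
move=> a1 k; have [I0|/fset0Pn//] := eqVneq (I k) fset0.
by have := a1 k; rewrite I0 big_seq_fset0 => /esym/eqP; rewrite oner_eq0.
Qed.

(** The new blocks are the unions of [I k] over [k] in [J j], with coefficient [b k * a n] at [n] in
    [I k]. *)
Lemma convex_block_trans (V : lmodType R) (x y z : nat -> V) :
  convex_block_subseq x y -> convex_block_subseq y z -> convex_block_subseq x z.
Proof.
move=> [I [a [I_incr a0 a1 yE]]] [J [b [J_incr b0 b1 zE]]].
have I_neq0 := block_neq0 a1; have J_neq0 := block_neq0 b1.
have [c [c0 cE]] := glue_coefficients I_neq0 I_incr
  (fun k n => mulr_ge0 (b0 k) (a0 n)).
have disj (j k l : nat) : k \in J j -> l \in J j -> k != l ->
    [disjoint I k & I l]%fset.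
  move=> _ _ kl; apply/fdisjointP => n nk; apply/negP => nl.
  by move/eqP: kl; apply; exact: block_inj nk nl.
exists (fun j => \bigcup_(k <- J j) I k)%fset, c; split=> //.
- move=> j m n /bigfcupP[k]; rewrite andbT => kj mk /bigfcupP[l].
  by rewrite andbT => lj nl; exact: block_lt (J_incr _ _ _ kj lj) mk nl.
- move=> j; rewrite partition_disjoint_bigfcup; last exact: disj.
  rewrite -(b1 j); apply: eq_big_seq => k kj.
  rewrite (eq_big_seq _ (cE k)) -big_distrr/= a1 mulr1//.
- move=> j; rewrite zE partition_disjoint_bigfcup; last exact: disj.
  apply: eq_big_seq => k kj; rewrite yE scaler_sumr; apply: eq_big_seq => n nk.
  by rewrite (cE k)// scalerA.
Qed.

Lemma convex_block_image (V W : lmodType R) (h : {linear V -> W})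
    (x : nat -> V) (y : nat -> W) :
  convex_block_subseq (h \o x) y ->
  exists2 z, convex_block_subseq x z & forall k, y k = h (z k).
Proof.
move=> [I [a [I_incr a0 a1 yE]]].
exists (fun k => \sum_(n <- I k) a n *: x n); first by exists I, a.
by move=> k; rewrite yE linear_sum; apply: eq_bigr => n _; rewrite linearZ.
Qed.

Lemma convex_block_map (V W : lmodType R) (h : {linear V -> W})
    (x y : nat -> V) :
  convex_block_subseq x y -> convex_block_subseq (h \o x) (h \o y).
Proof.
move=> [I [a [I_incr a0 a1 yE]]]; exists I, a; split=> // k.
by rewrite /= yE linear_sum; apply: eq_bigr => n _; rewrite linearZ.
Qed.

(** The [k]-th block lies beyond [k], so [y k] averages terms that are all close to [l]. *)
Lemma convex_block_cvg (V : normedModType R) (x y : nat -> V) (l : V) :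
  convex_block_subseq x y -> x @ \oo --> l -> y @ \oo --> l.
Proof.
move=> [I [a [I_incr a0 a1 yE]]] /cvgrPdist_le xl; apply/cvgrPdist_le => e e0.
have [N _ NP] := xl e e0; exists N => // k /= Nk.
rewrite yE -[l]scale1r -(a1 k) scaler_suml -sumrB.
rewrite (le_trans (ler_norm_sum _ _ _))// -[leRHS]mul1r -(a1 k) mulr_suml.
rewrite big_seq [leRHS]big_seq; apply: ler_sum => n nk.
rewrite -scalerBr normrZ ger0_norm// ler_wpM2l// NP//=.
exact: leq_trans Nk (block_ge (block_neq0 a1) I_incr nk).
Qed.

(** Every tail of [u] has convex combinations arbitrarily close to [l], by separation. Starting each
    tail past the previous block makes the supports successive. *)
Lemma mazur (V : normedModType R) (u : nat -> V) (l : V) :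
  u @ \oo --> (l : weak V) ->
  exists2 v, convex_block_subseq u v & v @ \oo --> l.
Proof.
move=> /weak_cvgP ul.
(* Coefficients vanish off [A], so that two combinations can be rewritten over the union of their
   supports. *)
pose comb N (A : {fset nat}) (a : nat -> R) := [/\
  forall n, n \in A -> (N <= n)%N,
  forall n, 0 <= a n, forall n, n \notin A -> a n = 0 & \sum_(n <- A) a n = 1].
have small N e : 0 < e -> exists p : {fset nat} * (nat -> R),
    comb N p.1 p.2 /\ `|\sum_(n <- p.1) p.2 n *: (u n - l)| < e.
  (* Otherwise the convex hull [C] of the tail of [u n - l] stays at distance [e] from [0], and a
     separating [f] has [f (u n - l) >= e] for all [n >= N], against weak convergence. *)
  move=> e0; apply: contrapT => none.
  pose C := [set \sum_(n <- p.1) p.2 n *: (u n - l) |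
    p in [set p : {fset nat} * (nat -> R) | comb N p.1 p.2]].
  have Cu n : (N <= n)%N -> C (u n - l).
    move=> Nn; exists ([fset n]%fset, fun m => (m == n)%:R) => /=; last first.
      by rewrite big_seq_fset1 eqxx scale1r.
    split=> [m|m|m|]; rewrite ?inE ?big_seq_fset1 ?eqxx//; first by move/eqP->.
    by move/negbTE ->.
  have [|||f _ fC] := @dual_separation R V C e e0.
  - by exists (u N - l); exact: Cu.
  - move=> _ _ t [[A a] /= [AN a0 aA a1] <-] [[B b] /= [BN b0 bB b1] <-].
    move=> /andP[t0 t1].
    have sumA : \sum_(n <- A) a n *: (u n - l) =
        \sum_(n <- (A `|` B)%fset) a n *: (u n - l).
      apply: big_fset_incl => [|n _ /aA ->]; [exact: fsubsetUl|exact: scale0r].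
    have sumB : \sum_(n <- B) b n *: (u n - l) =
        \sum_(n <- (A `|` B)%fset) b n *: (u n - l).
      apply: big_fset_incl => [|n _ /bB ->]; [exact: fsubsetUr|exact: scale0r].
    exists ((A `|` B)%fset, fun n => t * a n + (1 - t) * b n) => /=.
      split.
      + by move=> n; rewrite inE => /orP[/AN|/BN].
      + by move=> n; rewrite addr_ge0// mulr_ge0// subr_ge0.
      + move=> n; rewrite inE negb_or => /andP[/aA -> /bB ->].
        by rewrite !mulr0 addr0.
      + rewrite big_split/= -!mulr_sumr.
        have -> : \sum_(n <- (A `|` B)%fset) a n = 1.
          rewrite -a1; apply/esym/big_fset_incl => [|n _ /aA//].
          exact: fsubsetUl.
        have -> : \sum_(n <- (A `|` B)%fset) b n = 1.
          rewrite -b1; apply/esym/big_fset_incl => [|n _ /bB//].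
          exact: fsubsetUr.
        by rewrite !mulr1 addrC subrK.
    rewrite sumA sumB !scaler_sumr -big_split/=; apply: eq_bigr => n _.
    by rewrite [LHS]scalerDl !scalerA.
  - move=> _ [p pC <-]; rewrite leNgt; apply/negP => pe.
    by apply: none; exists p.
  have /cvgrPdist_lt/(_ e e0)[M _ MP] := ul f.
  have := MP (maxn M N) (leq_maxl _ _); have := fC _ (Cu _ (leq_maxr M N)).
  rewrite linearB/= => fle /=; rewrite distrC => /(le_lt_trans (ler_norm _)).
  by move=> /(le_lt_trans fle); rewrite ltxx.
pose r k : R := k.+1%:R^-1.
have r0 k : 0 < r k by rewrite invr_gt0.
have [pick pickP] : {pick : nat * nat -> {fset nat} * (nat -> R) & forall Nk,
    comb Nk.1 (pick Nk).1 (pick Nk).2 /\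
    `|\sum_(n <- (pick Nk).1) (pick Nk).2 n *: (u n - l)| < r Nk.2}.
  apply: (@choice _ _ (fun Nk p => comb Nk.1 p.1 p.2 /\
    `|\sum_(n <- p.1) p.2 n *: (u n - l)| < r Nk.2)) => Nk.
  exact: small.
(* [st k] is the least index allowed in block [k]: one past the maximum of the previous block. *)
pose fix st k := if k is k'.+1
  then (\max_(n <- (pick (st k', k')).1) n)%N.+1 else 0%N.
pose I k := (pick (st k, k)).1; pose alpha k := (pick (st k, k)).2.
have I_incr k m n : m \in I k -> n \in I k.+1 -> (m < n)%N.
  move=> mk; have [[+ _ _ _] _] := pickP (st k.+1, k.+1) => /[apply].
  by apply: leq_trans; rewrite ltnS; apply: (@leq_bigmax_seq _ _ xpredT id).
have alpha1 k : \sum_(n <- I k) alpha k n = 1 by have [[]] := pickP (st k, k).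
have I_neq0 k : exists n, n \in I k.
  exact: (block_neq0 (I := fun=> I k) (fun=> alpha1 k) k).
have [|a [a0 aE]] := glue_coefficients I_neq0 I_incr (alpha := alpha).
  by move=> k n; have [[_ + _ _] _] := pickP (st k, k); exact.
have a1 k : \sum_(n <- I k) a n = 1 by rewrite (eq_big_seq _ (aE k)).
exists (fun k => \sum_(n <- I k) a n *: u n); first by exists I, a.
apply/cvgrPdist_lt => e e0; near=> k.
rewrite distrC -[l]scale1r -(a1 k) scaler_suml -sumrB.
under eq_bigr do rewrite -scalerBr.
rewrite (eq_big_seq (fun n => alpha k n *: (u n - l))) => [|n /aE -> //].
have [_ /lt_trans ->//] := pickP (st k, k).
near: k; exact: near_infty_natSinv_lt (PosNum e0).
Unshelve. all: by end_near. Qed.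

End ConvexBlocks.

(** * Property (K) for quotients and extensions *)

Section PropertyK.
Context {R : realType}.

Lemma weakstar_convex_block (X : normedModType R) (u v : nat -> dual X)
    (f : dual X) : convex_block_subseq u v ->
  u @ \oo --> (f : weakstar X) -> v @ \oo --> (f : weakstar X).
Proof.
move=> uv /weakstar_cvgP uf; apply/weakstar_cvgP => x.
exact: (convex_block_cvg (convex_block_map (canonical_embedding x) uv)) (uf x).
Qed.

(** Singletons are weakly compact. *)
Lemma mackey_pointwise_cvg (X : normedModType R) (u : nat -> dual X)
    (f : dual X) (x : X) :
  u @ \oo --> (f : mackey X) -> (fun n => u n x : R^o) @ \oo --> f x.
Proof.
move=> /mackey_cvgP/(_ [set x] (@compact_set1 (weak X) x)) uf.
apply/cvgrPdist_lt => e e0; refine (@filterS _ \oo _ _ _ _ (uf e e0)) => n.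
exact.
Qed.

Variables (X : completeNormedModType R) (Y : closedSubspace X).

Lemma dual_restrict_linear : linear (@dual_restrict R X Y).
Proof. by move=> a f g; apply/val_inj/funext. Qed.

HB.instance Definition _ := GRing.isLinear.Build _ _ _ _ (@dual_restrict R X Y)
  dual_restrict_linear.

Lemma dual_pullback_linear : linear (@dual_pullback R X Y).
Proof. by move=> a f g; apply/val_inj/funext. Qed.

HB.instance Definition _ := GRing.isLinear.Build _ _ _ _ (@dual_pullback R X Y)
  dual_pullback_linear.

Lemma qproj_csub_val (y : csubType Y) : qproj Y (csub_val y) = 0.
Proof.
by rewrite -(raddf0 (qproj Y)); apply/qproj_eq; rewrite subr0 csub_valP.
Qed.

Lemma property_K_quotient : reflexive_space (csubType Y) -> property_K X ->
  property_K (quotient_space Y).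
Proof.
move=> reflY KX u [f /weakstar_cvgP uf].
have [|v' /convex_block_image[v uv vE] [g vg]] := KX (@dual_pullback R X Y \o u).
  by exists (dual_pullback f); apply/weakstar_cvgP => x; exact: uf.
(* Each [v' n] vanishes on [Y], hence so does its pointwise limit [g], which therefore factors
   through the quotient. *)
have [y|h hg] := @dual_factor _ _ Y g.
  have /cvg_unique := @mackey_pointwise_cvg X v' g (csub_val y) vg; apply.
    exact: norm_hausdorff.
  rewrite (_ : (fun n => _) = fun=> 0); first exact: cvg_cst.
  by apply/funext => n; rewrite vE /= qproj_csub_val linear0.
exists v => //; exists h; apply/mackey_cvgP => K wK e e0.
have [S wS KS] := weakly_compact_lift reflY wK.
move/mackey_cvgP : vg => /(_ S wS e e0).
refine (@filterS _ \oo _ _ _ _) => n nS z /KS[x Sx <-].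
by have := nS x Sx; rewrite vE -hg.
Qed.

Lemma property_K_extension : grothendieck_space (csubType Y) ->
  property_K (quotient_space Y) -> property_K X.
Proof.
move=> GY KQ u [f uf].
have [|g ug] := GY (@dual_restrict R X Y \o u).
  exists (dual_restrict Y f); move/weakstar_cvgP : uf => uf.
  by apply/weakstar_cvgP => y; exact: uf.
have [v0 /convex_block_image[v uv v0E] v0g] := mazur ug.
have [w wP] : {w : nat -> dual X & forall k,
    (forall y : csubType Y, w k (csub_val y) = v k (csub_val y) - g y) /\
    `|w k| <= `|dual_restrict Y (v k) - g|}.
  apply: (@choice _ _ (fun k (wk : dual X) =>
    (forall y : csubType Y, wk (csub_val y) = v k (csub_val y) - g y) /\
    `|wk| <= `|dual_restrict Y (v k) - g|)) => k.
  by have [wk wkE wkle] := dual_extension (dual_restrict Y (v k) - g); exists wk.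
have w0 : w @ \oo --> (0 : dual X).
  apply/cvgrPdist_lt => e e0; move/cvgrPdist_lt : v0g => /(_ e e0).
  refine (@filterS _ \oo _ _ _ _) => n; rewrite v0E sub0r normrN distrC.
  by apply: le_lt_trans; have [] := wP n.
have [G GE _] := dual_extension g.
have [t tP] : {t : nat -> dual (quotient_space Y) & forall k,
    dual_pullback (t k) = v k - w k - G}.
  apply: (@choice _ _ (fun k tk => dual_pullback tk = v k - w k - G)) => k.
  apply: dual_factor => y.
  rewrite [LHS](_ : _ = v k (csub_val y) - w k (csub_val y) - G (csub_val y))//.
  by rewrite GE (proj1 (wP k)) subKr subrr.
(* This limit identifies the weak* limit of [t]: it shows that [f - G] vanishes on [Y], and hence is
   the pullback of some [t0]. *)
have vGx x : (fun k => dual_pullback (t k) x : R^o) @ \oo --> f x - G x.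
  have /weakstar_cvgP/(_ x) vx := weakstar_convex_block uv uf.
  have wx : (fun k => w k x : R^o) @ \oo --> (0 : R^o).
    have := continuous_cvg _ (@dual_continuous _ _ (canonical_embedding x) 0) w0.
    exact.
  rewrite (_ : (fun k => _) = fun k => (v k x : R^o) - w k x - G x).
    rewrite -[f x]subr0; apply: cvgB; last exact: cvg_cst.
    exact: cvgB.
  by apply/funext => k; rewrite tP.
have [y|t0 t0E] := @dual_factor _ _ Y (f - G).
  have /cvg_unique := vGx (csub_val y); apply; first exact: norm_hausdorff.
  rewrite (_ : (fun n => _) = fun=> 0); first exact: cvg_cst.
  by apply/funext => n; rewrite /= qproj_csub_val linear0.
have [|s [J [b [J_incr b0 b1 sE]]] [s0 ss0]] := KQ t.
  exists t0; apply/weakstar_cvgP => z; have [x <-] := qproj_surj z.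
  by have := vGx x; rewrite [f x - G x](_ : _ = (f - G) x)// -t0E.
(* The blocks found for [t] are applied to [v] and [w] as well; the constant [G] is unchanged
   because the weights sum to 1. *)
pose block (V : lmodType R) (x : nat -> V) k := \sum_(n <- J k) b n *: x n.
have blockP (V : lmodType R) (x : nat -> V) : convex_block_subseq x (block V x).
  by exists J, b.
exists (block _ v); first exact: convex_block_trans uv (blockP _ v).
have zE k : block _ v k = dual_pullback (s k) + block _ w k + G.
  rewrite sE linear_sum -[G in RHS]scale1r -(b1 k) scaler_suml -!big_split/=.
  apply: eq_bigr => n _; rewrite linearZ/= tP -!scalerDr.
  by rewrite addrAC !subrK.
have bw0 := convex_block_cvg (blockP _ w) w0.
exists (dual_pullback s0 + G); apply/mackey_cvgP => K wK e e0.
have [M M0 KM] := weakly_compact_bounded wK.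
have wqK : weakly_compact (qproj Y @` K).
  by apply: weakly_compact_image wK => h; exists (dual_pullback h).
have e2 : 0 < e / 2 by rewrite divr_gt0.
have M1 : 0 < M + 1 by rewrite ltr_wpDl.
(* With [|x| <= M] on [K], a norm below [e / 2 / (M + 1)] keeps the contribution of [w] within
   [e / 2]; the [+ 1] covers [M = 0]. *)
move/cvgrPdist_lt : bw0 => /(_ _ (divr_gt0 e2 M1)) bw0.
have {}ss0 : \forall k \near \oo, forall z, (qproj Y @` K) z ->
    `|s0 z - s k z| < e / 2 by move/mackey_cvgP : ss0; exact.
refine (@filterS _ \oo _ _ _ _ (filterI ss0 bw0)) => k [/= sk wk] x Kx.
rewrite zE.
have -> : (dual_pullback s0 + G) x - (dual_pullback (s k) + block _ w k + G) x =
    (s0 (qproj Y x) - s k (qproj Y x)) + (0 - block _ w k) x.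
  rewrite -[LHS]/((dual_pullback s0 + G -
    (dual_pullback (s k) + block _ w k + G)) x).
  by rewrite opprD addrACA subrr addr0 opprD addrA sub0r.
rewrite (le_lt_trans (ler_normD _ _))// [e]splitr ltr_leD//.
  by apply: sk; exists x.
rewrite (le_trans (dual_le _ _))// (le_trans (ler_wpM2r _ (ltW wk)))//.
rewrite mulrAC ler_pdivrMr// ler_wpM2l ?(ltW e2)//.
by rewrite (le_trans (KM x Kx))// lerDl.
Qed.

End PropertyK.

Theorem theorem2p6 (R : realType) (X : completeNormedModType R)
    (Y : closedSubspace X) :
  (reflexive_space (csubType Y) -> property_K X ->
     property_K (quotient_space Y)) /\
  (grothendieck_space (csubType Y) -> property_K (quotient_space Y) ->
     property_K X).
Proof.
by split; [exact: property_K_quotient|exact: property_K_extension].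
Qed.
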